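(* Let $\mathcal{M}=(\mathbb{R}^2,\nabla)$ be a Type $\mathcal{A}$ surface. Then $\mathcal{M}$ is geodesically complete if and only if $\mathcal{M}$ is linearly equivalent to $\mathcal{M}_0^6$, to $\mathcal{M}_4^6$, to $\mathcal{M}_3^4(-\frac12)$, or to $\mathcal{M}_2^2(-1,a)$ for some $a\in\mathbb{R}$.
   Context: A Type $\mathcal{A}$ surface is a pair $(\mathbb{R}^2,\nabla)$ where $\nabla$ is a torsion free connection on the tangent bundle of $\mathbb{R}^2$ whose Christoffel symbols, defined by $\nabla_{\partial_{x^i}}\partial_{x^j}=\Gamma_{ij}{}^k\partial_{x^k}$ (summation convention), are constant in the standard coordinates $(x^1,x^2)$. Denote by $\mathcal{M}(a,b,c,d,e,f)$ the Type $\mathcal{A}$ surface with $\Gamma_{11}{}^1=a$, $\Gamma_{11}{}^2=b$, $\Gamma_{12}{}^1=\Gamma_{21}{}^1=c$, $\Gamma_{12}{}^2=\Gamma_{21}{}^2=d$, $\Gamma_{22}{}^1=e$, $\Gamma_{22}{}^2=f$. Two Type $\mathcal{A}$ surfaces are linearly equivalent if some element of $\operatorname{GL}(2,\mathbb{R})$, acting on $\mathbb{R}^2$, intertwines the two connections. A geodesic is a smooth curve $\sigma$ with $\nabla_{\dot\sigma}\dot\sigma=0$, i.e. $\ddot\sigma^k+\Gamma_{ij}{}^k\dot\sigma^i\dot\sigma^j=0$ for all $k$; $\mathcal{M}$ is geodesically complete if every geodesic extends to be defined for all $t\in\mathbb{R}$. The structures named are $\mathcal{M}_0^6=\mathcal{M}(0,0,0,0,0,0)$,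 $\mathcal{M}_4^6=\mathcal{M}(0,0,0,0,1,0)$, $\mathcal{M}_3^4(c)=\mathcal{M}(0,0,c,0,0,1+2c)$ (so $\mathcal{M}_3^4(-\frac12)=\mathcal{M}(0,0,-\frac12,0,0,0)$), and $\mathcal{M}_2^2(b_1,b_2)=\mathcal{M}\left(1+b_1,0,b_2,1,\frac{1+b_2^2}{b_1-1},0\right)$ (so $\mathcal{M}_2^2(-1,a)=\mathcal{M}\left(0,0,a,1,-\frac{1+a^2}{2},0\right)$). *)

(* Defs.v *)
From Stdlib Require Import Reals Lra FunctionalExtensionality.
From Coquelicot Require Import Coquelicot.
Open Scope R_scope.

Definition R2 : Type := (R * R)%type.

Inductive idx : Set := i1 | i2.

Definition coord (k : idx) (p : R2) : R :=
  match k with i1 => fst p | i2 => snd p end.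

Definition vec (g : idx -> R) : R2 := (g i1, g i2).

Definition sum2 (g : idx -> R) : R := g i1 + g i2.

Definition slice (i : idx) (f : R2 -> R) (p : R2) : R -> R :=
  match i with
  | i1 => fun s => f (s, snd p)
  | i2 => fun s => f (fst p, s)
  end.

Definition pd (i : idx) (f : R2 -> R) (p : R2) : R :=
  Derive (slice i f p) (coord i p).

Fixpoint Cn (n : nat) (f : R2 -> R) : Prop :=
  (forall p : R2, continuous f p) /\
  match n with
  | O => True
  | S m => forall i : idx,
      (forall p : R2, ex_derive (slice i f p) (coord i p)) /\ Cn m (pd i f)
  end.

Definition smooth (f : R2 -> R) : Prop := forall n : nat, Cn n f.

Definition vfield : Type := R2 -> R2.

Definition smooth_vfield (X : vfield) : Prop :=
  forall k : idx, smooth (fun p => coord k (X p)).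

(* The derivative X f of a function f along a vector field X. *)
Definition dir (X : vfield) (f : R2 -> R) (p : R2) : R :=
  sum2 (fun i => coord i (X p) * pd i f p).

Definition lie_bracket (X Y : vfield) : vfield := fun p =>
  vec (fun k => dir X (fun q => coord k (Y q)) p
                - dir Y (fun q => coord k (X q)) p).

Definition coord_field (i : idx) : vfield := fun _ =>
  match i with i1 => (1, 0) | i2 => (0, 1) end.

(* The axioms only concern smooth arguments: the values of a connection on
   non-smooth vector fields are irrelevant. *)
Record is_connection (nabla : vfield -> vfield -> vfield) : Prop := {
  conn_smooth : forall X Y, smooth_vfield X -> smooth_vfield Y ->
    smooth_vfield (nabla X Y);
  conn_addl : forall X X' Y,
    smooth_vfield X -> smooth_vfield X' -> smooth_vfield Y -> forall p,
    nabla (fun q => plus (X q) (X' q)) Y p = plus (nabla X Y p) (nabla X' Y p);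
  conn_scall : forall (f : R2 -> R) X Y,
    smooth f -> smooth_vfield X -> smooth_vfield Y -> forall p,
    nabla (fun q => scal (f q) (X q)) Y p = scal (f p) (nabla X Y p);
  conn_addr : forall X Y Y',
    smooth_vfield X -> smooth_vfield Y -> smooth_vfield Y' -> forall p,
    nabla X (fun q => plus (Y q) (Y' q)) p = plus (nabla X Y p) (nabla X Y' p);
  conn_leibniz : forall (f : R2 -> R) X Y,
    smooth f -> smooth_vfield X -> smooth_vfield Y -> forall p,
    nabla X (fun q => scal (f q) (Y q)) p =
    plus (scal (dir X f p) (Y p)) (scal (f p) (nabla X Y p))
}.

Definition torsion_free (nabla : vfield -> vfield -> vfield) : Prop :=
  forall X Y, smooth_vfield X -> smooth_vfield Y -> forall p,
  minus (nabla X Y p) (nabla Y X p) = lie_bracket X Y p.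

Definition christoffel (nabla : vfield -> vfield -> vfield)
    (i j k : idx) (p : R2) : R :=
  coord k (nabla (coord_field i) (coord_field j) p).

Record typeA : Type := TypeA {
  nabla :> vfield -> vfield -> vfield;
  typeA_connection : is_connection nabla;
  typeA_torsion_free : torsion_free nabla;
  typeA_constant : forall (i j k : idx) (p q : R2),
    christoffel nabla i j k p = christoffel nabla i j k q
}.

Definition dcurve (n : nat) (s : R -> R2) (k : idx) (t : R) : R :=
  Derive_n (fun u => coord k (s u)) n t.

(* Only the values of the curve s on the open interval ]a, b[ matter. *)
Definition is_geodesic (M : typeA) (a b : Rbar) (s : R -> R2) : Prop :=
  forall t : R, Rbar_lt a t -> Rbar_lt t b ->
    (forall (k : idx) (n : nat), ex_derive_n (fun u => coord k (s u)) n t) /\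
    (forall k : idx,
       dcurve 2 s k t +
       sum2 (fun i => sum2 (fun j =>
         christoffel M i j k (s t) * dcurve 1 s i t * dcurve 1 s j t)) = 0).

Definition geodesically_complete (M : typeA) : Prop :=
  forall (a b : Rbar) (s : R -> R2), Rbar_lt a b -> is_geodesic M a b s ->
  exists s' : R -> R2, is_geodesic M m_infty p_infty s' /\
    forall t : R, Rbar_lt a t -> Rbar_lt t b -> s' t = s t.

Record GL2 : Type := MkGL2 {
  m11 : R; m12 : R; m21 : R; m22 : R;
  GL2_det : m11 * m22 - m12 * m21 <> 0
}.

Definition act (T : GL2) (p : R2) : R2 :=
  (m11 T * fst p + m12 T * snd p, m21 T * fst p + m22 T * snd p).

Definition det (T : GL2) : R := m11 T * m22 T - m12 T * m21 T.

Definition act_inv (T : GL2) (p : R2) : R2 :=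
  ((m22 T * fst p - m12 T * snd p) / det T,
   (m11 T * snd p - m21 T * fst p) / det T).

Lemma act_invK (T : GL2) (p : R2) : act T (act_inv T p) = p.
Proof.
destruct T as [a b c d h], p as [x y]; unfold act, act_inv, det; simpl.
f_equal; field; exact h.
Qed.

Lemma actK (T : GL2) (p : R2) : act_inv T (act T p) = p.
Proof.
destruct T as [a b c d h], p as [x y]; unfold act, act_inv, det; simpl.
f_equal; field; exact h.
Qed.

(* T is linear, so it is its own differential. *)
Definition pushforward (T : GL2) (X : vfield) : vfield :=
  fun p => act T (X (act_inv T p)).

Definition linearly_equivalent (M N : typeA) : Prop :=
  exists T : GL2, forall X Y : vfield,
    smooth_vfield X -> smooth_vfield Y -> forall p : R2,
    N (pushforward T X) (pushforward T Y) p = pushforward T (M X Y) p.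

Definition cov (G : idx -> idx -> idx -> R) (X Y : vfield) : vfield := fun p =>
  vec (fun k => dir X (fun q => coord k (Y q)) p +
    sum2 (fun i => sum2 (fun j =>
      G i j k * coord i (X p) * coord j (Y p)))).

Lemma smooth_cont f p : smooth f -> continuous f p.
Proof. intros H; exact (proj1 (H O) p). Qed.

Lemma smooth_ex i f p : smooth f -> ex_derive (slice i f p) (coord i p).
Proof. intros H; exact (proj1 (proj2 (H 1%nat) i) p). Qed.

Lemma smooth_pd i f : smooth f -> smooth (pd i f).
Proof. intros H n; exact (proj2 (proj2 (H (S n)) i)). Qed.

Lemma slice_at i f p : slice i f p (coord i p) = f p.
Proof. destruct i, p; reflexivity. Qed.

Lemma pd_plus i f g p : smooth f -> smooth g ->
  pd i (fun q => f q + g q) p = pd i f p + pd i g p.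
Proof.
intros Hf Hg; unfold pd.
rewrite <- Derive_plus; try (apply smooth_ex; assumption).
destruct i; reflexivity.
Qed.

Lemma pd_mult i f g p : smooth f -> smooth g ->
  pd i (fun q => f q * g q) p = pd i f p * g p + f p * pd i g p.
Proof.
intros Hf Hg; unfold pd.
rewrite <- (slice_at i f p), <- (slice_at i g p) at 1.
rewrite <- Derive_mult; try (apply smooth_ex; assumption).
destruct i; reflexivity.
Qed.

Lemma pd_const i c p : pd i (fun _ => c) p = 0.
Proof. unfold pd; destruct i; simpl; apply Derive_const. Qed.

Lemma Cn_const n c : Cn n (fun _ => c).
Proof.
revert c; induction n as [|n IH]; intros c; split; try exact I;
  try (intros p; apply continuous_const).
intros i; split.
- intros p; destruct i; simpl; apply ex_derive_const.
- replace (pd i (fun _ => c)) with (fun _ : R2 => 0); [apply IH|].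
  apply functional_extensionality; intros p; now rewrite pd_const.
Qed.

Lemma smooth_const c : smooth (fun _ => c).
Proof. intros n; apply Cn_const. Qed.

Lemma Cn_add n f g : Cn n f -> Cn n g -> Cn n (fun p => f p + g p).
Proof.
revert f g; induction n as [|n IH]; intros f g [Cf Hf] [Cg Hg]; split;
  try exact I; try (intros p; apply (continuous_plus f g p); auto).
intros i; destruct (Hf i) as [Ef Pf], (Hg i) as [Eg Pg]; split.
- intros p; generalize (ex_derive_plus _ _ _ (Ef p) (Eg p));
    destruct i; exact (fun H => H).
- replace (pd i (fun p => f p + g p)) with (fun p => pd i f p + pd i g p).
  + apply IH; assumption.
  + apply functional_extensionality; intros p; unfold pd.
    rewrite <- Derive_plus; auto; destruct i; reflexivity.
Qed.

Lemma smooth_plus f g : smooth f -> smooth g -> smooth (fun p => f p + g p).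
Proof. intros Hf Hg n; apply Cn_add; [apply Hf | apply Hg]. Qed.

Lemma Cn_mult n f g : smooth f -> smooth g -> Cn n (fun p => f p * g p).
Proof.
revert f g; induction n as [|n IH]; intros f g Hf Hg; split; try exact I;
  try (intros p; apply (continuous_mult f g p); apply smooth_cont; assumption).
intros i; split.
- intros p; generalize (smooth_ex i f p Hf) (smooth_ex i g p Hg); intros A B.
  generalize (ex_derive_mult _ _ _ A B); destruct i; exact (fun H => H).
- replace (pd i (fun p => f p * g p))
    with (fun p => pd i f p * g p + f p * pd i g p).
  + apply Cn_add; apply IH; try apply smooth_pd; assumption.
  + apply functional_extensionality; intros p; now rewrite pd_mult.
Qed.

Lemma smooth_mult f g : smooth f -> smooth g -> smooth (fun p => f p * g p).
Proof. intros Hf Hg n; now apply Cn_mult. Qed.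

Lemma cov_connection G : is_connection (cov G).
Proof.
split.
- intros X Y HX HY k.
  assert (H : smooth (fun p => dir X (fun q => coord k (Y q)) p +
    sum2 (fun i => sum2 (fun j =>
      G i j k * coord i (X p) * coord j (Y p))))).
  { unfold dir, sum2.
    repeat apply smooth_plus; repeat apply smooth_mult;
      try apply smooth_const; try apply smooth_pd;
      first [apply HX | apply HY]. }
  destruct k; exact H.
- intros X X' Y HX HX' HY p; unfold cov, vec, dir, sum2, plus; simpl.
  unfold prod_plus, plus; simpl; f_equal; ring.
- intros f X Y Hf HX HY p; unfold cov, vec, dir, sum2, scal; simpl.
  unfold prod_scal, scal; simpl; unfold mult; simpl; f_equal; ring.
- intros X Y Y' HX HY HY' p.
  assert (H : forall i k, pd i (fun q => coord k (plus (Y q) (Y' q))) p =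
    pd i (fun q => coord k (Y q)) p + pd i (fun q => coord k (Y' q)) p).
  { intros i k; rewrite <- pd_plus by (apply HY || apply HY').
    destruct k; reflexivity. }
  unfold cov, vec, dir, sum2; rewrite !H; unfold plus; simpl.
  unfold prod_plus, plus; simpl; f_equal; ring.
- intros f X Y Hf HX HY p.
  assert (H : forall i k, pd i (fun q => coord k (scal (f q) (Y q))) p =
    pd i f p * coord k (Y p) + f p * pd i (fun q => coord k (Y q)) p).
  { intros i k; rewrite <- (pd_mult i f (fun q => coord k (Y q)))
      by (assumption || apply HY).
    destruct k; reflexivity. }
  unfold cov, vec, dir, sum2; rewrite !H; unfold plus, scal; simpl.
  unfold prod_plus, prod_scal, plus, scal; simpl; unfold mult; simpl.
  f_equal; ring.
Qed.

Lemma coord_vec k g : coord k (vec g) = g k.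
Proof. destruct k; reflexivity. Qed.

Lemma pd_const_coord i k j p : pd i (fun q => coord k (coord_field j q)) p = 0.
Proof. apply (pd_const i (coord k (coord_field j p)) p). Qed.

Lemma cov_christoffel G i j k p : christoffel (cov G) i j k p = G i j k.
Proof.
unfold christoffel, cov; rewrite coord_vec; unfold dir, sum2.
rewrite !(pd_const_coord _ k j); destruct i, j; simpl; ring.
Qed.

Lemma cov_torsion_free G :
  (forall i j k, G i j k = G j i k) -> torsion_free (cov G).
Proof.
intros HG X Y _ _ p.
unfold cov, lie_bracket, vec, sum2, minus, plus, opp; simpl.
unfold prod_plus, prod_opp, plus, opp; simpl.
rewrite (HG i2 i1 i1), (HG i2 i1 i2); f_equal; ring.
Qed.

Definition symbols (a b c d e f : R) (i j k : idx) : R :=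
  match i, j, k with
  | i1, i1, i1 => a
  | i1, i1, i2 => b
  | i1, i2, i1 | i2, i1, i1 => c
  | i1, i2, i2 | i2, i1, i2 => d
  | i2, i2, i1 => e
  | i2, i2, i2 => f
  end.

Lemma symbols_sym a b c d e f i j k :
  symbols a b c d e f i j k = symbols a b c d e f j i k.
Proof. destruct i, j, k; reflexivity. Qed.

Lemma cov_constant G i j k p q :
  christoffel (cov G) i j k p = christoffel (cov G) i j k q.
Proof. now rewrite !cov_christoffel. Qed.

Definition surf (a b c d e f : R) : typeA :=
  TypeA (cov (symbols a b c d e f))
    (cov_connection _)
    (cov_torsion_free _ (symbols_sym a b c d e f))
    (cov_constant _).

Definition M06 : typeA := surf 0 0 0 0 0 0.
Definition M46 : typeA := surf 0 0 0 0 1 0.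
Definition M34 (c : R) : typeA := surf 0 0 c 0 0 (1 + 2 * c).
Definition M22 (b1 b2 : R) : typeA :=
  surf (1 + b1) 0 b2 1 ((1 + b2 ^ 2) / (b1 - 1)) 0.

(* Main.v *)
Require Import Defs.
From Stdlib Require Import Reals Lra FunctionalExtensionality.
From Coquelicot Require Import Coquelicot.
Open Scope R_scope.

(** Along a geodesic of a surface with constant Christoffel symbols the
    velocity [v] solves the autonomous quadratic system [v' = - Q v], where
    [Q v = quad G v] has the components [G_ij^k v^i v^j], and the geodesic is an
    antiderivative of [v] (lemma [geodesic_velocity]).  Completeness is thus a
    property of the quadratic map [Q] alone, and linear equivalence of surfaces
    is linear conjugacy of these maps ([linearly_equivalent_conjugate]).

    If [Q v = v] with [v] nonzero, then [ln t] times [v] is a geodesic on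
    [t > 0] that cannot be continued to [t = 0].  One family of incomplete
    systems has no such [v], but it has geodesics [ln t * v + (ln t)^2 * w];
    call both kinds log rays ([complete_no_log_ray]).  Quadratic maps without a
    log ray can be listed.  The binary cubic [det (v, Q v)] has a real zero, so
    some direction is mapped to a multiple [mu v] of itself, and [mu] must be 0.
    Taking that direction as first axis gives [Q (x, y) = y * A (x, y)] with
    [A] linear.  A real eigenvector of [A] off the axis is again a direction
    preserved by [Q], so its eigenvalue vanishes.  Excluding also the rays with
    a squared logarithm, which occur when [A] is a Jordan block preserving the
    axis, one finds that either the image of [A] lies in the axis, or [A] is
    nilpotent, or [A] has no real eigenvalue.  A linear change of
    coordinates brings the first two cases to one of the first three surfaces
    of the list, and the last case to [M22 (-1) r], with [r] the
    ratio of the real to the imaginary part of an eigenvalue ([normal_forms]).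

    Conversely, for each of the four normal forms every initial velocity has a
    solution defined for all times.  By uniqueness of solutions any geodesic
    has the velocity of such a solution, whose antiderivative extends it
    ([velocity_complete_complete]).  Three of the systems are solved by
    elementary functions.  The orbits of [M22 (-1) r] off the axis are arcs of
    spirals; in a suitable parameter [z] of the arc the system becomes
    [z' = K F(z)] with [F] positive and bounded, which has global solutions
    ([velocity_complete_M22]). *)

(** * Quadratic maps up to linear conjugacy *)

Definition polar (G : idx -> idx -> idx -> R) (u v : R2) : R2 :=
  vec (fun k => sum2 (fun i => sum2 (fun j =>
    G i j k * coord i u * coord j v))).

Definition quad (G : idx -> idx -> idx -> R) (v : R2) : R2 := polar G v v.

Definition conjugate (G H : idx -> idx -> idx -> R) : Prop :=
  exists T : GL2, forall v, quad H (act T v) = act T (quad G v).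

Lemma quad_symbols a b c d e f x y :
  quad (symbols a b c d e f) (x, y) =
  (a * x ^ 2 + 2 * c * (x * y) + e * y ^ 2,
   b * x ^ 2 + 2 * d * (x * y) + f * y ^ 2).
Proof. unfold quad, polar, vec, sum2; simpl; f_equal; ring. Qed.

Lemma conjugate_refl G : conjugate G G.
Proof.
assert (h : 1 * 1 - 0 * 0 <> 0) by lra.
assert (E : forall v, act (MkGL2 1 0 0 1 h) v = v).
{ intros [x y]; unfold act; simpl; f_equal; ring. }
exists (MkGL2 1 0 0 1 h); intros v; now rewrite !E.
Qed.

Lemma conjugate_trans G H K :
  conjugate G H -> conjugate H K -> conjugate G K.
Proof.
intros [S HS] [T HT].
assert (h : (m11 T * m11 S + m12 T * m21 S) * (m21 T * m12 S + m22 T * m22 S)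
   - (m11 T * m12 S + m12 T * m22 S) * (m21 T * m11 S + m22 T * m21 S) <> 0).
{ generalize (Rmult_integral_contrapositive_currified _ _
    (GL2_det S) (GL2_det T)).
  intros h E; apply h; rewrite <- E; ring. }
pose (U := MkGL2 _ _ _ _ h).
assert (E : forall v, act U v = act T (act S v)).
{ intros [x y]; unfold act; simpl; f_equal; ring. }
exists U; intros v; now rewrite !E, HT, HS.
Qed.

Lemma conjugate_sym G H : conjugate G H -> conjugate H G.
Proof.
intros [T HT].
assert (hd : det T <> 0) by exact (GL2_det T).
assert (h : m22 T / det T * (m11 T / det T)
   - - m12 T / det T * (- m21 T / det T) <> 0).
{ replace (_ - _) with (/ det T); [now apply Rinv_neq_0_compat|].
  unfold det in *; field; assumption. }
pose (U := MkGL2 _ _ _ _ h).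
assert (E : forall v, act U v = act_inv T v).
{ intros [x y]; unfold act, act_inv; simpl; f_equal; field; assumption. }
exists U; intros v.
now rewrite !E, <- (act_invK T v) at 1; rewrite !actK, <- (actK T (quad G _)),
  <- HT, act_invK.
Qed.

(** Substituting [s t = ln t * v + (ln t)^2 * w] into the geodesic equation
    [s'' = - Q s'], with [l] standing for [ln t], leaves exactly this
    condition. *)
Definition log_ray (G : idx -> idx -> idx -> R) (v w : R2) : Prop :=
  forall l : R,
    quad G (fst v + 2 * l * fst w, snd v + 2 * l * snd w) =
    (fst v - 2 * fst w + 2 * l * fst w, snd v - 2 * snd w + 2 * l * snd w).

Definition has_log_ray (G : idx -> idx -> idx -> R) : Prop :=
  exists v w : R2, v <> (0, 0) /\ log_ray G v w.

Lemma conjugate_log_ray G H :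
  conjugate G H -> has_log_ray G -> has_log_ray H.
Proof.
intros [T HT] [v [w [Hv L]]].
exists (act T v), (act T w); split.
- intros E; apply Hv; rewrite <- (actK T v), E.
  unfold act_inv; simpl; f_equal; field; exact (GL2_det T).
- intros l; specialize (L l).
  generalize (HT (fst v + 2 * l * fst w, snd v + 2 * l * snd w)).
  rewrite L; unfold act; simpl; intros E.
  replace (_, _) with (m11 T * (fst v + 2 * l * fst w) +
      m12 T * (snd v + 2 * l * snd w),
      m21 T * (fst v + 2 * l * fst w) + m22 T * (snd v + 2 * l * snd w))
    by (f_equal; ring).
  rewrite E; f_equal; ring.
Qed.

(** By homogeneity [v / mu] is fixed by the quadratic map, so the ray has
    [w = 0]. *)
Lemma eigenvector_log_ray G v mu :
  quad G v = (mu * fst v, mu * snd v) -> v <> (0, 0) -> mu <> 0 ->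
  has_log_ray G.
Proof.
destruct v as [x y]; intros E Hv Hm.
exists (x / mu, y / mu), (0, 0); split.
- intros E'; injection E' as Ex Ey; apply Hv.
  f_equal; [replace x with (mu * (x / mu)) by (field; exact Hm)
    | replace y with (mu * (y / mu)) by (field; exact Hm)];
    [rewrite Ex | rewrite Ey]; ring.
- intros l; simpl.
  replace (quad G _) with (/ mu ^ 2 * fst (quad G (x, y)),
      / mu ^ 2 * snd (quad G (x, y))).
  + rewrite E; simpl; f_equal; field; exact Hm.
  + unfold quad, polar, vec, sum2; simpl; f_equal; field; exact Hm.
Qed.

(** A monic cubic has opposite signs at [N] and [- N] for [N] equal to 1 plus the
    sum of the absolute values of the lower coefficients. *)
Lemma cubic_root p q r s : p <> 0 ->
  exists x, p * x ^ 3 + q * x ^ 2 + r * x + s = 0.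
Proof.
intros Hp.
pose (f := fun x => x ^ 3 + q / p * x ^ 2 + r / p * x + s / p).
pose (N := 1 + Rabs (q / p) + Rabs (r / p) + Rabs (s / p)).
assert (HN : 1 <= N).
{ unfold N; generalize (Rabs_pos (q / p)) (Rabs_pos (r / p)) (Rabs_pos (s / p)).
  lra. }
assert (H : forall u A B C, Rabs u = 1 ->
   N = 1 + Rabs A + Rabs B + Rabs C ->
   0 < N ^ 3 + A * N ^ 2 * u + B * N + C * u).
{ intros u A B C Hu EN.
  assert (L : forall D, - Rabs D <= D * u /\ - Rabs D <= D).
  { intros D; split.
    - generalize (Rle_abs (- (D * u))).
      rewrite Rabs_Ropp, Rabs_mult, Hu; lra.
    - generalize (Rle_abs (- D)); rewrite Rabs_Ropp; lra. }
  destruct (L A) as [LA _], (L B) as [_ LB], (L C) as [LC _].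
  generalize (Rabs_pos A) (Rabs_pos B) (Rabs_pos C); intros PA PB PC.
  assert (N2 : N <= N ^ 2) by nra.
  assert (- Rabs A * N ^ 2 <= A * N ^ 2 * u) by nra.
  assert (- Rabs B * N ^ 2 <= B * N) by nra.
  assert (- Rabs C * N ^ 2 <= C * u) by nra.
  replace (N ^ 3) with (N ^ 2 + (Rabs A + Rabs B + Rabs C) * N ^ 2)
    by (rewrite EN; ring).
  nra. }
assert (Hpos : 0 < f N).
{ unfold f; generalize (H 1 (q / p) (r / p) (s / p) Rabs_R1 eq_refl); lra. }
assert (Hneg : f (- N) < 0).
{ assert (H1 : Rabs (-1) = 1) by (rewrite Rabs_left; lra).
  generalize (H (-1) (q / p) (r / p) (s / p) H1 eq_refl); unfold f; nra. }
destruct (IVT_cor f (- N) N) as [x [_ Hx]].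
- unfold f; reg.
- lra.
- nra.
- exists x; unfold f in Hx.
  replace (_ + s) with (p * (x ^ 3 + q / p * x ^ 2 + r / p * x + s / p))
    by (field; exact Hp).
  rewrite Hx; ring.
Qed.

(** A quadratic map of the plane always preserves some direction: the condition
    [det (v, Q v) = 0] is a binary cubic equation.  Without log rays the map
    vanishes on that direction, which becomes the first axis. *)
Lemma conjugate_null_axis a b c d e f :
  ~ has_log_ray (symbols a b c d e f) ->
  exists c' d' e' f',
    conjugate (symbols a b c d e f) (symbols 0 0 c' d' e' f').
Proof.
intros HG.
assert (N : forall a c d e f, ~ has_log_ray (symbols a 0 c d e f) -> a = 0).
{ clear; intros a c d e f HG.
  destruct (Req_dec a 0) as [|Ha]; [assumption|exfalso; apply HG].
  apply (eigenvector_log_ray _ (1, 0) a);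
    [|intros E; injection E; lra|exact Ha].
  rewrite quad_symbols; simpl; f_equal; ring. }
destruct (Req_dec b 0) as [Hb|Hb].
- subst b; exists c, d, e, f.
  rewrite (N _ _ _ _ _ HG).
  apply conjugate_refl.
(* The preserved direction is (x, 1); the change of coordinates
   (u, v) |-> (v, u - x v) sends it to (1, 0). *)
- destruct (cubic_root b (2 * d - a) (f - 2 * c) (- e) Hb) as [x Hx].
  assert (C : conjugate (symbols a b c d e f)
    (symbols (b * x ^ 2 + 2 * d * x + f) 0 (b * x + d)
       (a * x + c - x * (b * x + d)) b (a - x * b))).
  { assert (h : 0 * (- x) - 1 * 1 <> 0) by lra.
    exists (MkGL2 _ _ _ _ h); intros [u v]; rewrite quad_symbols.
    unfold act; simpl; rewrite quad_symbols; f_equal; [ring|].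
    transitivity (a * u ^ 2 + 2 * c * (u * v) + e * v ^ 2
      - x * (b * u ^ 2 + 2 * d * (u * v) + f * v ^ 2)
      + v ^ 2 * (b * x ^ 3 + (2 * d - a) * x ^ 2 + (f - 2 * c) * x + - e));
      [ring | rewrite Hx; ring]. }
  assert (HL := fun L => HG (conjugate_log_ray _ _ (conjugate_sym _ _ C) L)).
  rewrite (N _ _ _ _ _ HL) in C; do 4 eexists; exact C.
Qed.

(** Here [quad (x, y) = y * A (x, y)] with [A] linear, and the hypotheses say
    that [(x, 1)] is an eigenvector of [A] with eigenvalue [mu]. *)
Lemma pencil_log_ray c d e f x mu :
  2 * c * x + e = mu * x -> 2 * d * x + f = mu -> mu <> 0 ->
  has_log_ray (symbols 0 0 c d e f).
Proof.
intros E1 E2 Hm; apply (eigenvector_log_ray _ (x, 1) mu).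
- rewrite quad_symbols; simpl; f_equal; [rewrite <- E1 | rewrite <- E2]; ring.
- intros E; injection E; lra.
- exact Hm.
Qed.

(** The hypothesis says that the linear factor [A] of [quad (x, y)] has no real
    eigenvalue.  Its eigenvalues are [c + f / 2 +- i g]; rescaling [y] by [g]
    makes the imaginary part 1, and the new first coordinate is chosen so that
    the second component becomes twice the product of the coordinates. *)
Lemma conjugate_M22 c d e f : (2 * c - f) ^ 2 + 8 * d * e < 0 ->
  exists r, conjugate (symbols 0 0 c d e f)
    (symbols (1 + -1) 0 r 1 ((1 + r ^ 2) / (-1 - 1)) 0).
Proof.
intros Hdisc.
pose (g := sqrt (- 2 * d * e - (c - f / 2) ^ 2)).
assert (Hg : g * g = - 2 * d * e - (c - f / 2) ^ 2)
  by (apply sqrt_def; nra).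
assert (Hg0 : g <> 0) by (intros E; rewrite E in Hg; nra).
assert (Hd : d <> 0) by (intros E; rewrite E in Hdisc;
  generalize (pow2_ge_0 (2 * c - f)); lra).
assert (h : d * g - f / 2 * 0 <> 0).
{ rewrite Rmult_0_r, Rminus_0_r; now apply Rmult_integral_contrapositive. }
exists ((c + f / 2) / g), (MkGL2 _ _ _ _ h); intros [x y].
rewrite quad_symbols; unfold act; simpl; rewrite quad_symbols.
f_equal; [|field].
transitivity (2 * ((c + f / 2) * (d * x + f / 2 * y)) * y
  - / 2 * (g * g + (c + f / 2) ^ 2) * y ^ 2); [field; exact Hg0|].
rewrite Hg; field.
Qed.

Lemma normal_forms a b c d e f :
  ~ has_log_ray (symbols a b c d e f) ->
  conjugate (symbols a b c d e f) (symbols 0 0 0 0 0 0) \/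
  conjugate (symbols a b c d e f) (symbols 0 0 0 0 1 0) \/
  conjugate (symbols a b c d e f)
    (symbols 0 0 (- (1 / 2)) 0 0 (1 + 2 * (- (1 / 2)))) \/
  exists r, conjugate (symbols a b c d e f)
    (symbols (1 + -1) 0 r 1 ((1 + r ^ 2) / (-1 - 1)) 0).
Proof.
intros HG; destruct (conjugate_null_axis _ _ _ _ _ _ HG)
  as (c1 & d1 & e1 & f1 & C).
assert (HN : ~ has_log_ray (symbols 0 0 c1 d1 e1 f1)).
{ intros L; apply HG; exact (conjugate_log_ray _ _ (conjugate_sym _ _ C) L). }
enough (W : conjugate (symbols 0 0 c1 d1 e1 f1) (symbols 0 0 0 0 0 0) \/
  conjugate (symbols 0 0 c1 d1 e1 f1) (symbols 0 0 0 0 1 0) \/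
  conjugate (symbols 0 0 c1 d1 e1 f1)
    (symbols 0 0 (- (1 / 2)) 0 0 (1 + 2 * (- (1 / 2)))) \/
  exists r, conjugate (symbols 0 0 c1 d1 e1 f1)
    (symbols (1 + -1) 0 r 1 ((1 + r ^ 2) / (-1 - 1)) 0)).
{ destruct W as [W|[W|[W|[r W]]]]; [left|right;left|right;right;left
    |right;right;right; exists r]; exact (conjugate_trans _ _ _ C W). }
clear a b c d e f HG C; rename c1 into c, d1 into d, e1 into e, f1 into f.
destruct (Req_dec d 0) as [Hd|Hd].
- subst d.
  assert (Hf : f = 0).
  { destruct (Req_dec f 0) as [|Hf]; [assumption|exfalso; apply HN].
    destruct (Req_dec (2 * c) f) as [E|E].
    (* The linear factor has the single eigenvalue f; unless it is scalar, no
       eigenvector lies off the axis and the squared logarithm is needed. *)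
    - exists (0, / f), (- e / (2 * f ^ 2), 0); split.
      + intros E'; injection E' as E'; exact (Rinv_neq_0_compat _ Hf E').
      + intros l; simpl; rewrite quad_symbols, E; f_equal; field; exact Hf.
    - apply (pencil_log_ray _ _ _ _ (e / (f - 2 * c)) f); [field|ring|]; lra. }
  subst f; destruct (Req_dec c 0) as [Hc|Hc].
  + subst c; destruct (Req_dec e 0) as [He|He].
    * subst e; left; apply conjugate_refl.
    * right; left.
      assert (h : / e * 1 - 0 * 0 <> 0)
        by (generalize (Rinv_neq_0_compat _ He); lra).
      exists (MkGL2 _ _ _ _ h); intros [x y]; rewrite quad_symbols.
      unfold act; simpl; rewrite quad_symbols; f_equal; field; exact He.
  + right; right; left.
    assert (h : 1 * (- 2 * c) - e / (2 * c) * 0 <> 0) by lra.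
    exists (MkGL2 _ _ _ _ h); intros [x y]; rewrite quad_symbols.
    unfold act; simpl; rewrite quad_symbols; f_equal; field; exact Hc.
- destruct (Rlt_le_dec ((2 * c - f) ^ 2 + 8 * d * e) 0) as [D|D].
  + right; right; right; exact (conjugate_M22 _ _ _ _ D).
  (* Both real eigenvalues (2 c + f +- s) / 2 vanish, so the factor is
     nilpotent; its kernel is transverse to the axis, and minus the product of the
     coordinates (y, - 2 (d x - c y)) is the only component of the map. *)
  + assert (Hs := sqrt_def _ D).
    set (s := sqrt _) in Hs.
    assert (R : forall t, t * t = (2 * c - f) ^ 2 + 8 * d * e ->
      2 * c + f + t = 0).
    { intros t Ht; destruct (Req_dec (2 * c + f + t) 0) as [|N];
        [assumption|exfalso; apply HN].
      apply (pencil_log_ray _ _ _ _ ((2 * c - f + t) / (4 * d))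
        ((2 * c + f + t) / 2)); [|field; exact Hd|lra].
      apply (Rmult_eq_reg_r (8 * d)); [|lra].
      transitivity (4 * c * (2 * c - f + t) + 8 * d * e); [field; exact Hd|].
      transitivity ((2 * c + f + t) * (2 * c - f + t)); [|field; exact Hd].
      replace (8 * d * e) with (t * t - (2 * c - f) ^ 2) by (rewrite Ht; ring).
      ring. }
    generalize (R s Hs) (R (- s) ltac:(rewrite <- Hs; ring)); intros E1 E2.
    assert (Ef : f = - 2 * c) by lra.
    assert (Es : s = 0) by lra.
    assert (Ee : e = - 2 * c ^ 2 / d).
    { apply (Rmult_eq_reg_r (8 * d)); [|lra].
      rewrite Es, Ef in Hs; transitivity (- 16 * c ^ 2); [lra|field; exact Hd]. }
    right; right; left.
    assert (h : 0 * (2 * c) - 1 * (- 2 * d) <> 0) by lra.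
    exists (MkGL2 _ _ _ _ h); intros [x y]; rewrite quad_symbols.
    unfold act; simpl; rewrite quad_symbols, Ee, Ef; f_equal; field; exact Hd.
Qed.

(** * Connections with constant Christoffel symbols *)

Lemma smooth_coord_field i : smooth_vfield (coord_field i).
Proof. intros k; exact (smooth_const (coord k (coord_field i (0, 0)))). Qed.

Lemma smooth_scal f X :
  smooth f -> smooth_vfield X -> smooth_vfield (fun q => scal (f q) (X q)).
Proof.
intros Hf HX k; generalize (smooth_mult _ _ Hf (HX k)).
destruct k; exact (fun H => H).
Qed.

Lemma vfield_decomp (X : vfield) :
  X = fun q => plus (scal (coord i1 (X q)) (coord_field i1 q))
                    (scal (coord i2 (X q)) (coord_field i2 q)).
Proof.
apply functional_extensionality; intros q; destruct (X q) as [x y].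
unfold plus, scal; simpl; unfold prod_plus, prod_scal, plus, scal; simpl.
unfold mult; simpl; f_equal; ring.
Qed.

(** A connection is determined on smooth fields by its Christoffel symbols:
    expand both fields in the coordinate frame and use tensoriality in the
    first argument and the Leibniz rule in the second. *)
Lemma connection_cov N G X Y :
  is_connection N -> (forall i j k p, christoffel N i j k p = G i j k) ->
  smooth_vfield X -> smooth_vfield Y -> forall p, N X Y p = cov G X Y p.
Proof.
intros HN HG HX HY p.
assert (HE : forall i, N (coord_field i) Y p =
   plus (plus (scal (pd i (fun q => coord i1 (Y q)) p) (coord_field i1 p))
          (scal (coord i1 (Y p)) (N (coord_field i) (coord_field i1) p)))
     (plus (scal (pd i (fun q => coord i2 (Y q)) p) (coord_field i2 p))
          (scal (coord i2 (Y p)) (N (coord_field i) (coord_field i2) p)))).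
{ intros i; rewrite (vfield_decomp Y) at 1.
  rewrite (conn_addr _ HN), !(conn_leibniz _ HN);
    try apply smooth_scal; try apply smooth_coord_field; try apply HY.
  replace (dir (coord_field i)) with (pd i); [reflexivity|].
  apply functional_extensionality; intros f;
    apply functional_extensionality; intros q.
  unfold dir, sum2; destruct i; simpl; ring. }
rewrite (vfield_decomp X) at 1.
rewrite (conn_addl _ HN), !(conn_scall _ HN);
  try apply smooth_scal; try apply smooth_coord_field; try apply HX;
  try apply HY.
rewrite !HE.
assert (HC : forall i j, N (coord_field i) (coord_field j) p =
  (G i j i1, G i j i2)).
{ intros i j; rewrite <- !(HG _ _ _ p); unfold christoffel.
  now destruct (N (coord_field i) (coord_field j) p). }
rewrite !HC.
unfold cov, vec, dir, sum2, plus, scal; simpl.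
unfold prod_plus, prod_scal, plus, scal; simpl; unfold mult; simpl.
f_equal; ring.
Qed.

(** The symmetry of the symbols in the lower indices comes from the vanishing
    torsion, since coordinate fields commute. *)
Lemma typeA_symbols (M : typeA) : exists a b c d e f,
  forall i j k p, christoffel M i j k p = symbols a b c d e f i j k.
Proof.
pose (G := fun i j k => christoffel M i j k (0, 0)).
exists (G i1 i1 i1), (G i1 i1 i2), (G i1 i2 i1), (G i1 i2 i2), (G i2 i2 i1),
  (G i2 i2 i2).
assert (S : forall k, G i2 i1 k = G i1 i2 k).
{ intros k; unfold G, christoffel.
  generalize (typeA_torsion_free M _ _ (smooth_coord_field i2)
    (smooth_coord_field i1) (0, 0)).
  destruct (M (coord_field i2) (coord_field i1) (0, 0)) as [x y],
    (M (coord_field i1) (coord_field i2) (0, 0)) as [x' y'].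
  unfold lie_bracket, vec, dir, sum2; rewrite !pd_const_coord.
  unfold minus, plus, opp; simpl; unfold prod_plus, prod_opp, plus, opp; simpl.
  intros E; injection E; intros E2 E1; destruct k; simpl; lra. }
intros i j k p; rewrite (typeA_constant M i j k p (0, 0)).
change (christoffel M i j k (0, 0)) with (G i j k).
destruct i, j, k; first [reflexivity | exact (S i1) | exact (S i2)].
Qed.

(** The chain rule for an inner map that is affine along the [i]-th coordinate
    line.  Partial derivatives alone do not give it; [f] is differentiable
    because they are continuous. *)
Lemma pd_linear_comp f (u v : R2 -> R) a b i p :
  smooth f ->
  (forall s, slice i u p s = u p + a * (s - coord i p)) ->
  (forall s, slice i v p s = v p + b * (s - coord i p)) ->
  pd i (fun q => f (u q, v q)) p =
  a * pd i1 f (u p, v p) + b * pd i2 f (u p, v p).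
Proof.
intros Hf Hu Hv; unfold pd at 1.
apply is_derive_unique.
apply (is_derive_ext (fun s => (fun y z => f (y, z)) (slice i u p s)
  (slice i v p s))); [intros s; destruct i; reflexivity|].
apply is_derive_Reals.
rewrite (Rmult_comm a), (Rmult_comm b).
assert (L : forall (w : R2 -> R) c,
  (forall s, slice i w p s = w p + c * (s - coord i p)) ->
  derivable_pt_lim (slice i w p) (coord i p) c).
{ intros w c Hw; apply is_derive_Reals.
  apply (is_derive_ext (fun s => w p + c * (s - coord i p)));
    [intros s; now rewrite Hw|].
  auto_derive; trivial; ring. }
apply (derivable_pt_lim_comp_2d (fun y z => f (y, z))); [|now apply L ..].
rewrite !slice_at.
apply filterdiff_differentiable_pt_lim.
apply (is_derive_filterdiff (fun y z => f (y, z)) (u p) (v p)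
  (fun y z => pd i1 f (y, z))).
- exists (mkposreal 1 Rlt_0_1); intros [y z] _.
  apply Derive_correct, (smooth_ex i1 f (y, z) Hf).
- apply Derive_correct, (smooth_ex i2 f (u p, v p) Hf).
- generalize (smooth_cont _ (u p, v p) (smooth_pd i1 f Hf)).
  apply continuous_ext; now intros [].
Qed.

Lemma dir_pushforward T X f p : smooth f ->
  dir (pushforward T X) (fun q => f (act_inv T q)) p =
  dir X f (act_inv T p).
Proof.
intros Hf; assert (hd : det T <> 0) by exact (GL2_det T).
unfold dir, sum2.
change (fun q => f (act_inv T q)) with
  (fun q => f ((m22 T * fst q - m12 T * snd q) / det T,
   (m11 T * snd q - m21 T * fst q) / det T)).
rewrite (pd_linear_comp f _ _ (m22 T / det T) (- m21 T / det T) i1 p Hf)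
  by (intros s; simpl; field; exact hd).
rewrite (pd_linear_comp f _ _ (- m12 T / det T) (m11 T / det T) i2 p Hf)
  by (intros s; simpl; field; exact hd).
fold (act_inv T p); unfold pushforward; set (q := act_inv T p).
unfold act; simpl; unfold det in *; field; exact hd.
Qed.

Lemma dir_combination X f g a b p : smooth f -> smooth g ->
  dir X (fun q => a * f q + b * g q) p = a * dir X f p + b * dir X g p.
Proof.
intros Hf Hg; unfold dir, sum2.
assert (L : forall i, pd i (fun q => a * f q + b * g q) p =
  a * pd i f p + b * pd i g p).
{ intros i; rewrite pd_plus by (apply smooth_mult; auto using smooth_const).
  rewrite !(pd_mult i (fun _ => _)) by auto using smooth_const.
  rewrite !pd_const; ring. }
rewrite !L; ring.
Qed.

Lemma cov_const_field G v p : cov G (fun _ => v) (fun _ => v) p = quad G v.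
Proof.
unfold cov, dir, quad, polar, vec, sum2; rewrite !pd_const; f_equal; ring.
Qed.

(** Polarization: symmetric Christoffel symbols are recovered from the quadratic
    map, so conjugacy of quadratic maps is enough to intertwine connections. *)
Lemma polar_quad a b c d e f u v (G := symbols a b c d e f) :
  polar G u v =
  ((fst (quad G (fst u + fst v, snd u + snd v)) - fst (quad G u)
     - fst (quad G v)) / 2,
   (snd (quad G (fst u + fst v, snd u + snd v)) - snd (quad G u)
     - snd (quad G v)) / 2).
Proof.
destruct u as [u1 u2], v as [v1 v2]; unfold G; rewrite !quad_symbols.
unfold polar, vec, sum2; simpl; f_equal; field.
Qed.

(** Testing the intertwining relation on constant fields gives the conjugacy of
    the quadratic maps.  Conversely the derivative terms of the covariant
    derivative are intertwined by every linear map, by the chain rule, and the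
    remaining terms by polarization. *)
Lemma linearly_equivalent_conjugate (M : typeA) a b c d e f a' b' c' d' e' f' :
  (forall i j k p, christoffel M i j k p = symbols a b c d e f i j k) ->
  (linearly_equivalent M (surf a' b' c' d' e' f') <->
   conjugate (symbols a b c d e f) (symbols a' b' c' d' e' f')).
Proof.
intros HM; set (G := symbols a b c d e f) in *.
set (H := symbols a' b' c' d' e' f').
assert (EM : forall X Y, smooth_vfield X -> smooth_vfield Y ->
  forall p, M X Y p = cov G X Y p)
  by (intros; apply connection_cov; trivial; apply typeA_connection).
split; intros [T HT]; exists T.
- intros v; assert (Sv : smooth_vfield (fun _ => v))
    by (intros k; exact (smooth_const (coord k v))).
  generalize (HT _ _ Sv Sv (0, 0)).
  unfold pushforward at 3; rewrite (EM _ _ Sv Sv), (cov_const_field G v).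
  intros <-; symmetry; apply cov_const_field.
- intros X Y HX HY p; unfold pushforward at 3.
  rewrite (EM _ _ HX HY); set (q := act_inv T p).
  assert (P : polar H (act T (X q)) (act T (Y q)) =
    act T (polar G (X q) (Y q))).
  { unfold H, G; rewrite !polar_quad; fold H G.
    set (u := X q); set (v := Y q).
    replace (fst (act T u) + fst (act T v), snd (act T u) + snd (act T v))
      with (act T (fst u + fst v, snd u + snd v))
      by (unfold act; simpl; f_equal; ring).
    rewrite !HT; unfold act; cbn [fst snd]; f_equal; field. }
  assert (E : forall K U V r, cov K U V r =
     (dir U (fun q => coord i1 (V q)) r + fst (polar K (U r) (V r)),
      dir U (fun q => coord i2 (V q)) r + snd (polar K (U r) (V r))))
    by reflexivity.
  change (surf a' b' c' d' e' f' (pushforward T X) (pushforward T Y) p)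
    with (cov H (pushforward T X) (pushforward T Y) p).
  rewrite !E.
  change (pushforward T X p) with (act T (X q)).
  change (pushforward T Y p) with (act T (Y q)).
  rewrite P.
  assert (D : forall m n,
    dir (pushforward T X) (fun r => m * coord i1 (Y (act_inv T r)) +
      n * coord i2 (Y (act_inv T r))) p =
    m * dir X (fun r => coord i1 (Y r)) q +
    n * dir X (fun r => coord i2 (Y r)) q).
  { intros m n; rewrite <- dir_combination by apply HY.
    apply (dir_pushforward T X
      (fun r => m * coord i1 (Y r) + n * coord i2 (Y r))).
    apply smooth_plus; apply smooth_mult; auto using smooth_const; apply HY. }
  change (fun q => coord i1 (pushforward T Y q)) with
    (fun r => m11 T * coord i1 (Y (act_inv T r)) +
      m12 T * coord i2 (Y (act_inv T r))).
  change (fun q => coord i2 (pushforward T Y q)) with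
    (fun r => m21 T * coord i1 (Y (act_inv T r)) +
      m22 T * coord i2 (Y (act_inv T r))).
  rewrite !D; unfold act; simpl; f_equal; ring.
Qed.

(** * Geodesics and the velocity equation *)

(** If every member of a class has its derivative in the class, all members have
    derivatives of every order. *)
Lemma ex_derive_n_closed_class (a b : Rbar) (C : (R -> R) -> Prop) :
  (forall f, C f -> exists g, C g /\
     forall t : R, Rbar_lt a t -> Rbar_lt t b -> is_derive f t (g t)) ->
  forall f, C f -> forall n (t : R), Rbar_lt a t -> Rbar_lt t b ->
  ex_derive_n f n t.
Proof.
intros HC f Hf n.
assert (H : forall m, exists g, C g /\ forall t : R, Rbar_lt a t ->
  Rbar_lt t b -> Derive_n f m t = g t).
{ induction m as [|m [g [Cg Hg]]]; [now exists f|].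
  destruct (HC g Cg) as [h [Ch Hh]]; exists h; split; [exact Ch|].
  intros t Ha Hb; simpl; rewrite (Derive_ext_loc _ g).
  - now apply is_derive_unique, Hh.
  - now apply (locally_interval _ t a b). }
intros t Ha Hb; destruct n as [|n]; [exact I|].
destruct (H n) as [g [Cg Hg]], (HC g Cg) as [h [_ Hh]].
apply (ex_derive_ext_loc g).
- apply (locally_interval _ t a b); trivial; intros y Hy Hy'; symmetry; auto.
- exists (h t); auto.
Qed.

(** Polynomials in the velocity components of a solution are closed under
    differentiation along it, because the velocity equation is polynomial; this
    is what makes solutions smooth. *)
Inductive polynomial_in (x y : R -> R) : (R -> R) -> Prop :=
| poly_const c : polynomial_in x y (fun _ => c)
| poly_fst : polynomial_in x y x
| poly_snd : polynomial_in x y y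
| poly_plus f g : polynomial_in x y f -> polynomial_in x y g ->
    polynomial_in x y (fun t => f t + g t)
| poly_mult f g : polynomial_in x y f -> polynomial_in x y g ->
    polynomial_in x y (fun t => f t * g t).

Definition velocity_on (a b : Rbar) (G : idx -> idx -> idx -> R)
    (v : R -> R2) : Prop :=
  forall t : R, Rbar_lt a t -> Rbar_lt t b -> forall k,
    is_derive (fun u => coord k (v u)) t (- coord k (quad G (v t))).

Definition antiderivative_on (a b : Rbar) (v s : R -> R2) : Prop :=
  forall t : R, Rbar_lt a t -> Rbar_lt t b -> forall k,
    is_derive (fun u => coord k (s u)) t (coord k (v t)).

Lemma polynomial_in_derive a b G v f :
  velocity_on a b G v ->
  polynomial_in (fun t => coord i1 (v t)) (fun t => coord i2 (v t)) f ->
  exists g,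
    polynomial_in (fun t => coord i1 (v t)) (fun t => coord i2 (v t)) g /\
    forall t : R, Rbar_lt a t -> Rbar_lt t b -> is_derive f t (g t).
Proof.
intros Hv.
assert (Q : forall k, polynomial_in (fun t => coord i1 (v t))
  (fun t => coord i2 (v t)) (fun t => - 1 * coord k (quad G (v t)))).
{ intros k; unfold quad, polar, sum2.
  destruct k; simpl; repeat first [apply poly_fst | apply poly_snd
    | apply poly_const | apply poly_plus | apply poly_mult]. }
assert (E : forall t k, - 1 * coord k (quad G (v t)) =
   - coord k (quad G (v t))) by (intros; ring).
induction 1 as [c| | |f g Pf [f' [Pf' Hf]] Pg [g' [Pg' Hg]]
  |f g Pf [f' [Pf' Hf]] Pg [g' [Pg' Hg]]].
- exists (fun _ => 0); split; [constructor|].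
  intros t _ _; apply (is_derive_const (V := R_NormedModule) c t).
- exists (fun t => - 1 * coord i1 (quad G (v t))); split; [apply Q|].
  intros t Ha Hb; rewrite E; exact (Hv t Ha Hb i1).
- exists (fun t => - 1 * coord i2 (quad G (v t))); split; [apply Q|].
  intros t Ha Hb; rewrite E; exact (Hv t Ha Hb i2).
- exists (fun t => f' t + g' t); split; [now constructor|].
  intros t Ha Hb; apply (is_derive_plus f g); auto.
- exists (fun t => f' t * g t + f t * g' t); split; [now repeat constructor|].
  intros t Ha Hb; apply (is_derive_mult f g); auto; intros; apply Rmult_comm.
Qed.

Lemma geodesic_velocity (M : typeA) G a b s :
  (forall i j k p, christoffel M i j k p = G i j k) ->
  (is_geodesic M a b s <->
   exists v, antiderivative_on a b v s /\ velocity_on a b G v).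
Proof.
intros HM; split.
- intros Hs; exists (fun t => vec (fun k => dcurve 1 s k t)); split.
  + intros t Ha Hb k; rewrite coord_vec.
    apply Derive_correct, (proj1 (Hs t Ha Hb) k 1%nat).
  + intros t Ha Hb k; destruct (Hs t Ha Hb) as [D E].
    replace (- coord k _) with (dcurve 2 s k t).
    * apply (is_derive_ext (fun u => dcurve 1 s k u));
        [intros u; now rewrite coord_vec|].
      apply Derive_correct, (D k 2%nat).
    * generalize (E k); unfold quad, polar; rewrite coord_vec; unfold sum2.
      rewrite !HM, !coord_vec; lra.
- intros [v [Hs Hv]] t Ha Hb; split.
  + intros k n; apply (ex_derive_n_closed_class a b (fun f =>
      polynomial_in (fun t => coord i1 (v t)) (fun t => coord i2 (v t)) f \/
      exists k, f = fun u => coord k (s u))); eauto.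
    intros f [Pf|[j ->]].
    * destruct (polynomial_in_derive _ _ _ _ _ Hv Pf) as [g [Pg Hg]]; eauto.
    * exists (fun u => coord j (v u)); split; [left|auto].
      destruct j; constructor.
  + assert (D1 : forall k (u : R), Rbar_lt a u -> Rbar_lt u b ->
      dcurve 1 s k u = coord k (v u)).
    { intros k u Hu Hu'; exact (is_derive_unique _ _ _ (Hs u Hu Hu' k)). }
    assert (D2 : forall k, dcurve 2 s k t = - coord k (quad G (v t))).
    { intros k; unfold dcurve.
      change (Derive (fun u => dcurve 1 s k u) t = - coord k (quad G (v t))).
      rewrite (Derive_ext_loc _ (fun u => coord k (v u))).
      - exact (is_derive_unique _ _ _ (Hv t Ha Hb k)).
      - apply (locally_interval _ t a b); auto. }
    intros k; rewrite D2; unfold quad, polar; rewrite coord_vec; unfold sum2.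
    rewrite !HM, !D1 by assumption; ring.
Qed.

(** Comparing the values at [N] and [2 N] eliminates the quadratic term. *)
Lemma unbounded_quadratic p q B N0 :
  (forall N, N0 <= N -> Rabs (q * N ^ 2 - p * N) <= B) -> p = 0.
Proof.
intros H; destruct (Req_dec p 0) as [|Hp]; [assumption|exfalso].
assert (Pp := Rabs_pos_lt _ Hp).
assert (PB : 0 <= B)
  by (generalize (H N0 (Rle_refl _)) (Rabs_pos (q * N0 ^ 2 - p * N0)); lra).
pose (N := Rabs N0 + (3 * B + 1) / Rabs p).
assert (PN : (3 * B + 1) / Rabs p <= N)
  by (unfold N; generalize (Rabs_pos N0); lra).
assert (0 < (3 * B + 1) / Rabs p) by (apply Rdiv_lt_0_compat; lra).
assert (HN : N0 <= N) by (unfold N; generalize (Rle_abs N0); lra).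
assert (L : Rabs p * N <= 5 / 2 * B).
{ rewrite <- (Rabs_right N), <- Rabs_mult by lra.
  generalize (H N HN) (H (2 * N) ltac:(lra)).
  intros H1 H2; apply Rabs_le_between in H1, H2; apply Rabs_le_between; lra. }
assert (3 * B + 1 <= Rabs p * N).
{ replace (3 * B + 1) with (Rabs p * ((3 * B + 1) / Rabs p)) by (field; lra).
  apply Rmult_le_compat_l; lra. }
lra.
Qed.

(** The log ray is a geodesic on [t > 0] which is unbounded as [t] tends to 0,
    whereas an extension would be continuous there. *)
Lemma complete_no_log_ray (M : typeA) G :
  (forall i j k p, christoffel M i j k p = G i j k) ->
  geodesically_complete M -> ~ has_log_ray G.
Proof.
intros HM HC [v [w [Hv L]]].
pose (s := fun t => vec (fun k => coord k v * ln t + coord k w * ln t ^ 2)).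
pose (ds := fun t =>
  vec (fun k => (coord k v + 2 * ln t * coord k w) / t)).
destruct (HC 0 p_infty s I) as [s' [Hs' Es']].
- apply (geodesic_velocity _ _ _ _ _ HM); exists ds; split.
  + intros t Ht _ k; simpl in Ht; unfold ds; rewrite coord_vec.
    apply (is_derive_ext (fun u => coord k v * ln u + coord k w * ln u ^ 2));
      [intros u; unfold s; now rewrite coord_vec|].
    auto_derive; [lra|field; lra].
  + intros t Ht _ k; simpl in Ht.
    apply (is_derive_ext (fun u => (coord k v + 2 * ln u * coord k w) / u));
      [intros u; unfold ds; now rewrite coord_vec|].
    replace (- coord k _) with
      (- (coord k v - 2 * coord k w + 2 * ln t * coord k w) / t ^ 2).
    * auto_derive; [lra|field; lra].
    * assert (E : quad G (ds t) = vec (fun j => / t ^ 2 * coord j (quad G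
        (fst v + 2 * ln t * fst w, snd v + 2 * ln t * snd w)))).
      { unfold ds, quad, polar, vec, sum2; simpl; f_equal; field; lra. }
      rewrite E, coord_vec, L; destruct k; simpl; field; lra.
- apply Hv; rewrite (surjective_pairing v).
  assert (Z : forall k, coord k v = 0).
  { intros k.
    assert (Cs : continuity_pt (fun u => coord k (s' u)) 0).
    { apply derivable_continuous_pt, ex_derive_Reals_0.
      exact (proj1 (Hs' 0 I I) k 1%nat). }
    destruct (proj1 (continuity_pt_locally _ _) Cs (mkposreal 1 Rlt_0_1))
      as [d Hd]; simpl in Hd.
    (* For t = exp (- N) the ray has the coordinates - v N + w N^2, and
       N > - ln d means that t < d. *)
    apply (unbounded_quadratic _ (coord k w) (1 + Rabs (coord k (s' 0)))
      (1 - ln d)).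
    intros N HN; specialize (Hd (exp (- N))).
    assert (P := exp_pos (- N)).
    rewrite Es' in Hd by easy; unfold s in Hd; rewrite coord_vec, ln_exp in Hd.
    replace (_ - _) with (coord k v * - N + coord k w * (- N) ^ 2) by ring.
    set (z := coord k (s' 0)) in *; set (y := _ + _) in *.
    replace y with ((y - z) + z) by ring.
    apply (Rle_trans _ _ _ (Rabs_triang _ _)), Rplus_le_compat_r, Rlt_le, Hd.
    change (Rabs (exp (- N) - 0) < d); rewrite Rminus_0_r, Rabs_right by lra.
    rewrite <- (exp_ln d) by apply cond_pos; apply exp_increasing; lra. }
  now rewrite (Z i1 : fst v = 0), (Z i2 : snd v = 0).
Qed.

(** * Uniqueness and global velocities *)

Definition velocity_complete (G : idx -> idx -> idx -> R) : Prop :=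
  forall u, exists v, velocity_on m_infty p_infty G v /\ v 0 = u.

Lemma between_Rbar (a b : Rbar) (x y z : R) :
  Rbar_lt a x -> Rbar_lt x b -> Rbar_lt a y -> Rbar_lt y b ->
  Rmin x y <= z <= Rmax x y -> Rbar_lt a z /\ Rbar_lt z b.
Proof.
intros Hx Hx' Hy Hy' [L U]; split.
- apply (Rbar_lt_le_trans _ (Rmin x y)); [|exact L].
  now apply Rmin_case.
- apply (Rbar_le_lt_trans _ (Rmax x y)); [exact U|].
  now apply Rmax_case.
Qed.

(** Gronwall's argument: [D = p^2 + q^2] satisfies [|D'| <= 2 L D] on the
    compact interval between [t0] and [t], where [L] bounds the coefficients, so
    [D] times a suitable exponential does not increase away from [t0]. *)
Lemma linear_system_zero (a b : Rbar) (p q A B C E : R -> R) (t0 : R) :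
  Rbar_lt a t0 -> Rbar_lt t0 b ->
  (forall t : R, Rbar_lt a t -> Rbar_lt t b ->
     (continuity_pt A t /\ continuity_pt B t /\
      continuity_pt C t /\ continuity_pt E t) /\
     is_derive p t (A t * p t + B t * q t) /\
     is_derive q t (C t * p t + E t * q t)) ->
  p t0 = 0 -> q t0 = 0 ->
  forall t : R, Rbar_lt a t -> Rbar_lt t b -> p t = 0 /\ q t = 0.
Proof.
intros Ha0 Hb0 HS Hp0 Hq0 t Ha Hb.
assert (HI : forall z, Rmin t0 t <= z <= Rmax t0 t ->
  Rbar_lt a z /\ Rbar_lt z b) by (intros; now apply (between_Rbar a b t0 t)).
assert (HL : exists L, forall z, Rmin t0 t <= z <= Rmax t0 t ->
  Rabs (A z) + Rabs (B z) + Rabs (C z) + Rabs (E z) <= L).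
{ destruct (continuity_ab_maj
    (fun z => Rabs (A z) + Rabs (B z) + Rabs (C z) + Rabs (E z))
    (Rmin t0 t) (Rmax t0 t)) as [M [HM _]].
  - apply (Rle_trans _ t0); [apply Rmin_l | apply Rmax_l].
  - intros z Hz; destruct (HI z Hz) as [Hz1 Hz2].
    destruct (HS z Hz1 Hz2) as [[cA [cB [cC cE]]] _].
    assert (K : forall f, continuity_pt f z ->
      continuity_pt (fun y => Rabs (f y)) z)
      by (intros f Hf; apply (continuity_pt_comp f Rabs);
          [exact Hf | apply Rcontinuity_abs]).
    exact (continuity_pt_plus _ _ _ (continuity_pt_plus _ _ _
      (continuity_pt_plus _ _ _ (K A cA) (K B cB)) (K C cC)) (K E cE)).
  - eexists; exact HM. }
destruct HL as [L HL].
(* The sign of t - t0, so that times before and after t0 are treated alike. *)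
pose (sg := if Rle_dec t0 t then 1 else -1).
assert (Hsg : sg * (t - t0) = Rabs (t - t0)).
{ unfold sg; destruct (Rle_dec t0 t);
    [rewrite Rabs_right | rewrite Rabs_left]; lra. }
pose (D := fun z => p z ^ 2 + q z ^ 2).
pose (D' := fun z => 2 * p z * (A z * p z + B z * q z)
  + 2 * q z * (C z * p z + E z * q z)).
pose (W := fun z => exp (- (2 * L * sg) * (z - t0))).
assert (HD : forall z, Rmin t0 t <= z <= Rmax t0 t ->
  is_derive (fun y => D y * W y) z ((D' z - 2 * L * sg * D z) * W z)).
{ intros z Hz; destruct (HI z Hz) as [Hz1 Hz2].
  destruct (HS z Hz1 Hz2) as [_ [dp dq]]; unfold D, W.
  auto_derive.
  - repeat split; eexists; eassumption.
  - assert (Ep : Derive (fun x : R => p x) z = A z * p z + B z * q z)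
      by exact (is_derive_unique _ _ _ dp).
    assert (Eq : Derive (fun x : R => q x) z = C z * p z + E z * q z)
      by exact (is_derive_unique _ _ _ dq).
    rewrite Ep, Eq; unfold D'; change (z + - t0) with (z - t0); ring. }
destruct (MVT_gen (fun y => D y * W y) t0 t
  (fun z => (D' z - 2 * L * sg * D z) * W z)) as [z [Hz Ez]].
- intros z Hz; apply HD; split; apply Rlt_le; apply Hz.
- intros z Hz; apply derivable_continuous_pt, ex_derive_Reals_0.
  eexists; apply HD, Hz.
- assert (P0 : D t0 * W t0 = 0) by (unfold D; rewrite Hp0, Hq0; ring).
  rewrite P0 in Ez.
  assert (Wz := exp_pos (- (2 * L * sg) * (z - t0)) : 0 < W z).
  assert (Wt := exp_pos (- (2 * L * sg) * (t - t0)) : 0 < W t).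
  assert (Hb' : Rabs (D' z) <= 2 * L * D z).
  { specialize (HL z Hz).
    assert (X : Rabs (p z * q z) <= D z / 2).
    { unfold D; apply Rabs_le_between.
      generalize (pow2_ge_0 (p z + q z)) (pow2_ge_0 (p z - q z)); lra. }
    replace (D' z) with (2 * (A z * p z ^ 2 + B z * (p z * q z) +
      C z * (p z * q z) + E z * q z ^ 2)) by (unfold D'; ring).
    rewrite Rabs_mult, (Rabs_right 2) by lra.
    assert (Y : Rabs (A z * p z ^ 2 + B z * (p z * q z) +
      C z * (p z * q z) + E z * q z ^ 2) <= Rabs (A z) * p z ^ 2 +
      Rabs (B z) * Rabs (p z * q z) + Rabs (C z) * Rabs (p z * q z) +
      Rabs (E z) * q z ^ 2).
    { rewrite <- (Rabs_right (p z ^ 2)) at 2 by (apply Rle_ge, pow2_ge_0).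
      rewrite <- (Rabs_right (q z ^ 2)) at 2 by (apply Rle_ge, pow2_ge_0).
      rewrite <- !Rabs_mult.
      eapply Rle_trans; [apply Rabs_triang|apply Rplus_le_compat_r].
      eapply Rle_trans; [apply Rabs_triang|apply Rplus_le_compat_r].
      apply Rabs_triang. }
    assert (p z ^ 2 <= D z) by (unfold D; generalize (pow2_ge_0 (q z)); lra).
    assert (q z ^ 2 <= D z) by (unfold D; generalize (pow2_ge_0 (p z)); lra).
    assert (0 <= D z) by (generalize (pow2_ge_0 (q z)); lra).
    generalize (Rabs_pos (A z)) (Rabs_pos (B z)) (Rabs_pos (C z))
      (Rabs_pos (E z)); intros PA PB PC PE.
    assert (Rabs (A z) * p z ^ 2 <= Rabs (A z) * D z) by nra.
    assert (Rabs (E z) * q z ^ 2 <= Rabs (E z) * D z) by nra.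
    assert (Rabs (B z) * Rabs (p z * q z) <= Rabs (B z) * D z) by nra.
    assert (Rabs (C z) * Rabs (p z * q z) <= Rabs (C z) * D z) by nra.
    nra. }
  assert (Neg : (D' z - 2 * L * sg * D z) * (t - t0) <= 0).
  { replace (_ * (t - t0)) with
      (D' z * (t - t0) - 2 * L * D z * (sg * (t - t0))) by ring.
    rewrite Hsg; generalize (Rle_abs (D' z * (t - t0))); rewrite Rabs_mult.
    generalize (Rabs_pos (t - t0)); nra. }
  assert (DW : D t * W t <= 0) by nra.
  assert (Dt : D t <= 0) by nra.
  unfold D in Dt; generalize (pow2_ge_0 (p t)) (pow2_ge_0 (q t)); intros.
  split; apply Rsqr_0_uniq; unfold Rsqr; nra.
Qed.

(** The difference of two solutions of a quadratic system solves a linear system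
    whose coefficients are linear in the two solutions. *)
Lemma velocity_unique a b G v w (t0 : R) :
  velocity_on a b G v -> velocity_on a b G w ->
  Rbar_lt a t0 -> Rbar_lt t0 b -> v t0 = w t0 ->
  forall t : R, Rbar_lt a t -> Rbar_lt t b -> v t = w t.
Proof.
intros Hv Hw Ha0 Hb0 E0 t Ha Hb.
pose (coef := fun j k t =>
  - sum2 (fun i => G i j k * coord i (v t) + G j i k * coord i (w t))).
destruct (linear_system_zero a b
  (fun u => coord i1 (v u) - coord i1 (w u))
  (fun u => coord i2 (v u) - coord i2 (w u))
  (coef i1 i1) (coef i2 i1) (coef i1 i2) (coef i2 i2) t0 Ha0 Hb0)
  with (t := t) as [E1 E2]; trivial.
- intros u Hu Hu'.
  assert (Cz : forall z, velocity_on a b G z -> forall i c,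
    continuity_pt (fun t => c * coord i (z t)) u).
  { intros z Hz i c; apply continuity_pt_scal, derivable_continuous_pt,
      ex_derive_Reals_0.
    eexists; exact (Hz u Hu Hu' i). }
  assert (Cu : forall j k, continuity_pt (coef j k) u).
  { intros j k; exact (continuity_pt_opp _ _ (continuity_pt_plus _ _ _
      (continuity_pt_plus _ _ _ (Cz v Hv i1 _) (Cz w Hw i1 _))
      (continuity_pt_plus _ _ _ (Cz v Hv i2 _) (Cz w Hw i2 _)))). }
  split; [repeat split; apply Cu|].
  assert (Du : forall k, is_derive (fun u => coord k (v u) - coord k (w u)) u
    (coef i1 k u * (coord i1 (v u) - coord i1 (w u)) +
     coef i2 k u * (coord i2 (v u) - coord i2 (w u)))).
  { intros k; replace (_ + _) with
      (- coord k (quad G (v u)) - - coord k (quad G (w u)))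
      by (unfold coef, quad, polar; rewrite !coord_vec; unfold sum2; ring).
    apply (is_derive_minus (fun u => coord k (v u)) (fun u => coord k (w u)));
      auto. }
  split; apply Du.
- rewrite E0; ring.
- rewrite E0; ring.
- rewrite (surjective_pairing (v t)), (surjective_pairing (w t)).
  simpl in E1, E2; f_equal; lra.
Qed.

(** A geodesic has the velocity of a global solution by uniqueness; integrating
    that solution extends the geodesic. *)
Lemma velocity_complete_complete (M : typeA) G :
  (forall i j k p, christoffel M i j k p = G i j k) ->
  velocity_complete G -> geodesically_complete M.
Proof.
intros HM HG a b s Hab Hs.
apply (geodesic_velocity _ _ _ _ _ HM) in Hs; destruct Hs as [w [Hs Hw]].
assert (Ht0 : exists t0 : R, Rbar_lt a t0 /\ Rbar_lt t0 b).
{ destruct a as [a| |], b as [b| |]; simpl in Hab; try contradiction.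
  - exists ((a + b) / 2); simpl; lra.
  - exists (a + 1); simpl; lra.
  - exists (b - 1); simpl; lra.
  - now exists 0. }
destruct Ht0 as [t0 [Ha0 Hb0]], (HG (w t0)) as [v0 [Hv0 E0]].
pose (v := fun t => v0 (t - t0)).
assert (Hv : velocity_on m_infty p_infty G v).
{ intros t _ _ k; unfold v.
  generalize (is_derive_comp (fun u => coord k (v0 u)) (fun t => t - t0) t _ 1
    (Hv0 (t - t0) I I k)); unfold scal; simpl; unfold mult; simpl.
  rewrite Rmult_1_l; intros H; apply H; auto_derive; trivial. }
assert (Hvw : forall t : R, Rbar_lt a t -> Rbar_lt t b -> v t = w t).
{ apply (velocity_unique a b G v w t0); trivial.
  - intros t _ _; exact (Hv t I I).
  - unfold v; now rewrite Rminus_diag. }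
assert (Cv : forall k t, continuous (fun u => coord k (v u)) t).
{ intros k t; apply (ex_derive_continuous (V := R_NormedModule)).
  eexists; exact (Hv t I I k). }
pose (s' := fun t => vec (fun k =>
  coord k (s t0) + RInt (fun u => coord k (v u)) t0 t)).
assert (Hs' : antiderivative_on m_infty p_infty v s').
{ intros t _ _ k.
  apply (is_derive_ext (fun t => coord k (s t0) +
    RInt (fun u => coord k (v u)) t0 t));
    [intros u; unfold s'; now rewrite coord_vec|].
  rewrite <- (Rplus_0_l (coord k (v t))).
  apply (is_derive_plus (fun _ => coord k (s t0))
     (fun t => RInt (fun u => coord k (v u)) t0 t));
    [apply (is_derive_const (V := R_NormedModule))|].
  apply (is_derive_RInt (fun u => coord k (v u)) _ t0); [|apply Cv].
  exists (mkposreal 1 Rlt_0_1); intros y _;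
    apply (RInt_correct (V := R_CompleteNormedModule)).
  apply (ex_RInt_continuous (V := R_CompleteNormedModule)); intros; apply Cv. }
exists s'; split; [apply (geodesic_velocity _ _ _ _ _ HM); now exists v|].
intros t Ha Hb.
assert (E : forall k, coord k (s' t) = coord k (s t)).
{ intros k.
  assert (D : forall u : R, Rbar_lt a u -> Rbar_lt u b -> is_derive
    (fun u => coord k (s' u) - coord k (s u)) u 0).
  { intros u Hu Hu'; rewrite <- (Rminus_diag (coord k (v u))).
    rewrite (Hvw u Hu Hu') at 2.
    apply (is_derive_minus (fun u => coord k (s' u)) (fun u => coord k (s u)));
      [exact (Hs' u I I k) | exact (Hs u Hu Hu' k)]. }
  destruct (MVT_gen (fun u => coord k (s' u) - coord k (s u)) t0 t
    (fun _ => 0)) as [c [_ Ec]].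
  - intros z Hz; destruct (between_Rbar a b t0 t z) as [Hz1 Hz2]; auto.
    split; apply Rlt_le; apply Hz.
  - intros z Hz; apply derivable_continuous_pt, ex_derive_Reals_0.
    destruct (between_Rbar a b t0 t z) as [Hz1 Hz2]; auto.
    eexists; apply D; assumption.
  - assert (E : coord k (s' t0) = coord k (s t0)).
    { unfold s'; rewrite coord_vec, (RInt_point (V := R_CompleteNormedModule)).
      apply Rplus_0_r. }
    lra. }
rewrite (surjective_pairing (s' t)), (surjective_pairing (s t)).
f_equal; [exact (E i1) | exact (E i2)].
Qed.

Lemma conjugate_velocity_complete G H :
  conjugate G H -> velocity_complete H -> velocity_complete G.
Proof.
intros C HH u; destruct (conjugate_sym _ _ C) as [T HT].
destruct (HH (act_inv T u)) as [v [Hv E0]].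
exists (fun t => act T (v t)); split; [|now rewrite E0, act_invK].
intros t _ _ k; rewrite HT.
assert (D : forall m n, is_derive
  (fun u => m * coord i1 (v u) + n * coord i2 (v u)) t
  (- (m * coord i1 (quad H (v t)) + n * coord i2 (quad H (v t))))).
{ intros m n; replace (- _) with (m * - coord i1 (quad H (v t)) +
    n * - coord i2 (quad H (v t))) by ring.
  apply (is_derive_plus (fun u => m * coord i1 (v u))
    (fun u => n * coord i2 (v u)));
    apply (is_derive_scal (fun u => coord _ (v u))), Hv; exact I. }
destruct k; apply D.
Qed.

(** * Global velocities of the normal forms *)

(** The time [H x] needed to reach [x] from [z0] is the integral of [/ F].  As
    [F <= B], its slope is at least [/ B], so [H] is a bijection of the line
    with a Lipschitz inverse; that inverse is the solution. *)
Lemma autonomous_ode (F : R -> R) (B : R) (z0 : R) :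
  (forall x, continuity_pt F x) -> (forall x, 0 < F x <= B) ->
  exists z : R -> R, z 0 = z0 /\ forall t, is_derive z t (F (z t)).
Proof.
intros CF HF.
assert (HB : 0 < B) by (destruct (HF 0); lra).
assert (CI : forall x, continuous (fun y => / F y) x).
{ intros x; apply continuity_pt_filterlim, (continuity_pt_inv F);
    [apply CF | destruct (HF x); lra]. }
pose (H := fun x => RInt (fun y => / F y) z0 x).
assert (DH : forall x, is_derive H x (/ F x)).
{ intros x; apply (is_derive_RInt (fun y => / F y) _ z0); [|apply CI].
  exists (mkposreal 1 Rlt_0_1); intros y _.
  apply (RInt_correct (V := R_CompleteNormedModule)).
  apply (ex_RInt_continuous (V := R_CompleteNormedModule)); auto. }
assert (CH : continuity H).
{ intros x; apply derivable_continuous_pt, ex_derive_Reals_0.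
  eexists; apply DH. }
(* The mean value theorem for H, solved for the increment y - x: it gives the
   growth of H, and the difference quotients of its inverse. *)
assert (MV : forall x y, exists c, Rabs (c - x) <= Rabs (y - x) /\
  y - x = F c * (H y - H x)).
{ intros x y; destruct (MVT_gen H x y (fun c => / F c)) as [c [Hc E]].
  - intros c _; apply DH.
  - intros c _; apply CH.
  - exists c; split.
    + revert Hc; unfold Rmin, Rmax; destruct (Rle_dec x y); intros Hc;
        [rewrite !Rabs_right | rewrite !Rabs_left1]; lra.
    + rewrite E; field; destruct (HF c); lra. }
assert (H0 : H z0 = 0) by apply (RInt_point (V := R_CompleteNormedModule)).
assert (Up : forall t, 0 <= t -> t <= H (z0 + B * t)).
{ intros t Ht; destruct (MV z0 (z0 + B * t)) as [c [_ E]].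
  rewrite H0 in E; destruct (HF c) as [c1 c2].
  apply Rnot_lt_le; intros L.
  assert (F c * (H (z0 + B * t) - 0) < B * t) by nra; lra. }
assert (Dn : forall t, t <= 0 -> H (z0 + B * t) <= t).
{ intros t Ht; destruct (MV z0 (z0 + B * t)) as [c [_ E]].
  rewrite H0 in E; destruct (HF c) as [c1 c2].
  apply Rnot_lt_le; intros L.
  assert (B * t < F c * (H (z0 + B * t) - 0)) by nra; lra. }
assert (Sur : forall t, {x | H x = t}).
{ intros t; destruct (IVT_gen H (z0 + B * - Rabs t) (z0 + B * Rabs t) t CH)
    as [x [_ Hx]]; [|now exists x].
  assert (P := Rabs_pos t).
  assert (L1 := Dn (- Rabs t) ltac:(lra)); assert (L2 := Up (Rabs t) P).
  destruct (Rabs_le_between t (Rabs t)) as [T _]; specialize (T (Rle_refl _)).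
  rewrite Rmin_left, Rmax_right by lra; lra. }
pose (z := fun t => proj1_sig (Sur t)).
assert (Hz : forall t, H (z t) = t) by (intros t; apply (proj2_sig (Sur t))).
exists z; split.
- destruct (MV z0 (z 0)) as [c [_ E]]; rewrite Hz, H0 in E; lra.
- intros t; apply is_derive_Reals; intros eps Heps.
  destruct (proj1 (continuity_pt_locally _ _) (CF (z t)) (mkposreal eps Heps))
    as [d Hd].
  assert (Pd : 0 < d / B) by (apply Rdiv_lt_0_compat; [apply cond_pos|lra]).
  exists (mkposreal _ Pd); intros h h0 Hh; simpl in Hh.
  destruct (MV (z t) (z (t + h))) as [c [Hc E]].
  rewrite !Hz in E; replace (t + h - t) with h in E by ring.
  rewrite E; replace (F c * h / h) with (F c) by (field; exact h0).
  apply Hd; apply (Rle_lt_trans _ _ _ Hc); rewrite E, Rabs_mult.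
  destruct (HF c); rewrite (Rabs_right (F c)) by lra.
  assert (Ph := Rabs_pos h).
  replace (pos d) with (B * (d / B)) by (field; lra); nra.
Qed.

Lemma cosh_sinh x : cosh x ^ 2 = 1 + sinh x ^ 2.
Proof.
unfold cosh, sinh; rewrite exp_Ropp; field; generalize (exp_pos x); lra.
Qed.

Lemma cosh_pos x : 0 < cosh x.
Proof.
unfold cosh; generalize (exp_pos x) (exp_pos (- x)); lra.
Qed.

Lemma velocity_on_pair G (x y : R -> R) :
  (forall t, is_derive x t (- fst (quad G (x t, y t)))) ->
  (forall t, is_derive y t (- snd (quad G (x t, y t)))) ->
  velocity_on m_infty p_infty G (fun t => (x t, y t)).
Proof. intros Hx Hy t _ _ [|]; [exact (Hx t) | exact (Hy t)]. Qed.

Lemma velocity_complete_M06 : velocity_complete (symbols 0 0 0 0 0 0).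
Proof.
intros [x y]; exists (fun _ => (x, y)); split; [|reflexivity].
apply velocity_on_pair; intros t; rewrite quad_symbols; simpl;
  auto_derive; trivial; ring.
Qed.

Lemma velocity_complete_M46 : velocity_complete (symbols 0 0 0 0 1 0).
Proof.
intros [x y]; exists (fun t => (x - y ^ 2 * t, y)); split; [|f_equal; ring].
apply velocity_on_pair; intros t; rewrite quad_symbols; simpl;
  auto_derive; trivial; ring.
Qed.

Lemma velocity_complete_M34 :
  velocity_complete (symbols 0 0 (- (1 / 2)) 0 0 (1 + 2 * (- (1 / 2)))).
Proof.
intros [x y]; exists (fun t => (x * exp (y * t), y)); split;
  [|rewrite Rmult_0_r, exp_0; f_equal; ring].
apply velocity_on_pair; intros t; rewrite quad_symbols; simpl;
  auto_derive; trivial; field.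
Qed.

(** Off the axis [y = 0] set [sinh z = 2 x / y - r].  Along a solution
    [z' = y * cosh z], and [y] as a function of [z] satisfies
    [dy / dz = - y * (r + sinh z) / cosh z], that is
    [y = K * F z / cosh z] with [F z = exp (- r * atan (sinh z))].  Hence
    [z' = K * F z], where [F] is positive and bounded because [atan] is. *)
Lemma velocity_complete_M22 r :
  velocity_complete (symbols (1 + -1) 0 r 1 ((1 + r ^ 2) / (-1 - 1)) 0).
Proof.
intros [x0 y0]; destruct (Req_dec y0 0) as [->|Hy].
{ exists (fun _ => (x0, 0)); split; [|reflexivity].
  apply velocity_on_pair; intros t; rewrite quad_symbols; simpl;
    auto_derive; trivial; field. }
pose (F := fun z => exp (- r * atan (sinh z))).
assert (DF : forall z, is_derive F z (- r / cosh z * F z)).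
{ intros z; unfold F.
  assert (Ds : is_derive sinh z (cosh z))
    by apply is_derive_Reals, derivable_pt_lim_sinh.
  assert (Da := is_derive_comp atan sinh z _ _ (is_derive_atan _) Ds).
  assert (De := is_derive_comp exp (fun z => - r * atan (sinh z)) z _ _
    (is_derive_exp _) (is_derive_scal _ _ (- r) _ Da)).
  replace (- r / cosh z * _) with
    (- r * (cosh z * / (1 + (sinh z)²)) * exp (- r * atan (sinh z)));
    [exact De|].
  assert (P := cosh_pos z).
  replace (1 + (sinh z)²) with (cosh z ^ 2)
    by (rewrite cosh_sinh; unfold Rsqr; ring).
  field; lra. }
pose (z0 := arcsinh (2 * x0 / y0 - r)).
pose (K := y0 * cosh z0 / F z0).
destruct (autonomous_ode F (exp (Rabs r * (PI / 2))) z0) as [z [Ez Dz]].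
{ intros w; apply derivable_continuous_pt, ex_derive_Reals_0.
  eexists; apply DF. }
{ intros w; split; [apply exp_pos|].
  assert (A : - r * atan (sinh w) <= Rabs r * (PI / 2)).
  { destruct (atan_bound (sinh w)).
    apply (Rle_trans _ _ _ (Rle_abs _)).
    rewrite Rabs_mult, Rabs_Ropp; apply Rmult_le_compat_l; [apply Rabs_pos|].
    apply Rabs_le_between; lra. }
  unfold F; destruct A as [A|A];
    [left; now apply exp_increasing | rewrite A; apply Rle_refl]. }
pose (y := fun t => K * F (z (K * t)) / cosh (z (K * t))).
pose (x := fun t => (sinh (z (K * t)) + r) / 2 * y t).
assert (Dzk : forall t, is_derive (fun t => z (K * t)) t (K * F (z (K * t)))).
{ intros t; apply (is_derive_comp z (fun t => K * t) t); [apply Dz|].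
  auto_derive; trivial; ring. }
assert (DY : forall t, is_derive y t (- 2 * (x t * y t))).
{ intros t; set (w := z (K * t)).
  assert (P := cosh_pos w).
  assert (Q : is_derive (fun w => K * F w / cosh w) w
    (K * ((- r / cosh w * F w) * cosh w - F w * sinh w) / cosh w ^ 2)).
  { replace (_ / _) with ((K * (- r / cosh w * F w) * cosh w -
      (K * F w) * sinh w) / cosh w ^ 2) by (field; lra).
    apply (is_derive_div (fun w => K * F w) cosh); [| |lra].
    - apply (is_derive_scal F), DF.
    - apply is_derive_Reals, derivable_pt_lim_cosh. }
  replace (- 2 * (x t * y t)) with (K * F w *
    (K * ((- r / cosh w * F w) * cosh w - F w * sinh w) / cosh w ^ 2)).
  - exact (is_derive_comp (fun w => K * F w / cosh w)
      (fun u => z (K * u)) t _ _ Q (Dzk t)).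
  - unfold x, y; fold w; field; lra. }
exists (fun t => (x t, y t)); split.
- apply velocity_on_pair; intros t; rewrite quad_symbols; simpl.
  + assert (P := cosh_pos (z (K * t))).
    assert (S : is_derive (fun t => (sinh (z (K * t)) + r) / 2) t
      (K * F (z (K * t)) * (cosh (z (K * t)) / 2))).
    { assert (Q : is_derive (fun w => (sinh w + r) / 2) (z (K * t))
        (cosh (z (K * t)) / 2)).
      { apply (is_derive_ext (fun w => / 2 * (sinh w + r)));
          [intros; simpl; field|].
        replace (cosh (z (K * t)) / 2) with (/ 2 * (cosh (z (K * t)) + 0))
          by field.
        apply (is_derive_scal (fun w => sinh w + r)).
        apply (is_derive_plus sinh (fun _ => r));
          [apply is_derive_Reals, derivable_pt_lim_sinh
          | apply (is_derive_const (V := R_NormedModule))]. }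
      exact (is_derive_comp (fun w => (sinh w + r) / 2)
        (fun u => z (K * u)) t _ _ Q (Dzk t)). }
    replace (- _) with (K * F (z (K * t)) * (cosh (z (K * t)) / 2) * y t +
      (sinh (z (K * t)) + r) / 2 * (- 2 * (x t * y t))).
    * apply (is_derive_mult (fun t => (sinh (z (K * t)) + r) / 2) y);
        auto; intros; apply Rmult_comm.
    * set (w := z (K * t)) in *.
      replace (K * F w * (cosh w / 2)) with (y t * cosh w ^ 2 / 2)
        by (unfold y; fold w; field; lra).
      rewrite cosh_sinh; unfold x; fold w; field.
  + replace (- _) with (- 2 * (x t * y t)) by field; apply DY.
- assert (P := cosh_pos z0); assert (PF := exp_pos (- r * atan (sinh z0))).
  change (0 < F z0) in PF.
  assert (Ey : y 0 = y0).
  { unfold y; rewrite Rmult_0_r, Ez; unfold K; field; lra. }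
  unfold x; rewrite Ey, Rmult_0_r, Ez; f_equal.
  unfold z0; rewrite sinh_arcsinh; field; exact Hy.
Qed.

(** * Classification *)

Theorem theorem1p7 (M : typeA) :
  geodesically_complete M <->
  (linearly_equivalent M M06 \/
   linearly_equivalent M M46 \/
   linearly_equivalent M (M34 (- (1 / 2))) \/
   exists a : R, linearly_equivalent M (M22 (-1) a)).
Proof.
destruct (typeA_symbols M) as (a & b & c & d & e & f & HM).
unfold M06, M46, M34, M22; split.
- intros HC.
  destruct (normal_forms a b c d e f (complete_no_log_ray M _ HM HC))
    as [C|[C|[C|[r C]]]];
    [left | right; left | right; right; left | right; right; right; exists r];
    exact (proj2 (linearly_equivalent_conjugate M _ _ _ _ _ _ _ _ _ _ _ _ HM) C).
- intros HL; apply (velocity_complete_complete M _ HM).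
  destruct HL as [L|[L|[L|[r L]]]];
    apply (linearly_equivalent_conjugate M _ _ _ _ _ _ _ _ _ _ _ _ HM) in L;
    apply (conjugate_velocity_complete _ _ L).
  + exact velocity_complete_M06.
  + exact velocity_complete_M46.
  + exact velocity_complete_M34.
  + exact (velocity_complete_M22 r).
Qed.
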